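(* Let $P(r)=a_kr^k+\cdots+a_1r+a_0$ with $k\geq1$, each $a_j\in\mathbb{Z}$ and $a_k>0$. If $N$ is sufficiently large (depending on $P$) and $A\subseteq[1,N]$ satisfies \[\frac{|A|}{N}\geq 4a_k^{1/k}\,N^{-1/k},\] then there exist $r',r''\in\mathbb{N}$ with $r'\neq r''$ such that \[P(r')-P(r'')\in A-A.\]
   Context: $[1,N]=\{1,2,\dots,N\}$; $A-A=\{a-a':a,a'\in A\}$. *)

(* Defs.v *)
From HB Require Import structures.
From mathcomp Require Import all_boot all_order all_algebra finmap.

Set Implicit Arguments.
Unset Strict Implicit.
Unset Printing Implicit Defensive.

Import Order.TTheory GRing.Theory Num.Theory.
Local Open Scope ring_scope.
Local Open Scope fset_scope.

Definition difference_set (A : {fset int}) : {fset int} :=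
  [fset (a - a')%R | a in A, a' in A].

(* Main.v *)
Require Import Defs.
From mathcomp Require Import all_boot all_order all_algebra finmap.
From mathcomp Require Import all_classical all_reals all_analysis.
From mathcomp Require Import zify.

Set Implicit Arguments.
Unset Strict Implicit.
Unset Printing Implicit Defensive.

Import Order.TTheory GRing.Theory Num.Theory.
Local Open Scope ring_scope.

(** Let M be the largest integer with a_k M^k <= N. If no difference
    P(r') - P(r'') with r' <> r'' lay in A - A, the sums a + P(r) with a in A
    and 1 <= r <= M would be pairwise distinct. They lie in an interval of
    length 2N + O(M^(k-1)) < 3N, whereas the density hypothesis gives
    |A| M >= 4N M / (M + 1) >= 3N. *)

(** Since [r] is at least 1, every lower power [r ^ i] with [i < k] is at most [r ^ k.-1]. *)
Lemma horner_lead_dist (k r : nat) (P : {poly int}) :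
  (0 < k)%N -> size P = k.+1 -> (0 < r)%N ->
  `|P.[r%:Z] - P`_k * r%:Z ^+ k| <= (\sum_(i < k) `|P`_i|) * r%:Z ^+ k.-1.
Proof.
move=> k_gt0 sizeP r_gt0.
rewrite horner_coef sizeP big_ord_recr /= addrK mulr_suml.
apply: le_trans (ler_norm_sum _ _ _) _; apply: ler_sum => i _.
rewrite normrM normrX ler_wpM2l //.
rewrite (_ : `|r%:Z| = r%:Z); last by lia.
by apply: ler_weXn2l; [lia | have := ltn_ord i; lia].
Qed.

Lemma exists_max_scaled_power (a k N : nat) : (0 < a)%N -> (0 < k)%N ->
  exists M : nat, (a * M ^ k <= N < a * M.+1 ^ k)%N.
Proof.
move=> a_gt0 k_gt0.
have ex0 : exists M, (a * M ^ k <= N)%N by exists 0%N; rewrite exp0n // muln0.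
have bnd M : (a * M ^ k <= N)%N -> (M <= N)%N.
  apply: leq_trans; rewrite -[leqLHS]mul1n leq_mul //.
  case: M => // M; rewrite -[leqLHS]expn1; exact: leq_pexp2l.
case: (ex_maxnP ex0 bnd) => M leM maxM; exists M; rewrite leM /=.
by rewrite ltnNge; apply/negP => /maxM; rewrite ltnn.
Qed.

Lemma powR_invn_expn (R : realType) (x : R) (k : nat) :
  (0 < k)%N -> 0 <= x -> (x `^ k%:R^-1) ^+ k = x.
Proof.
move=> k_gt0 x_ge0.
by rewrite -powR_mulrn ?powR_ge0 // -powRrM mulVf ?powRr1 // pnatr_eq0 -lt0n.
Qed.

(** Taking k-th roots in [N < a * M.+1 ^ k] bounds the density from below by 4 / (M + 1), which
    removes the real powers. *)
Lemma card_gt_of_density (R : realType) (a k N M c : nat) :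
  (0 < k)%N -> (0 < N)%N -> (N < a * M.+1 ^ k)%N ->
  c%:R / N%:R >= 4 * a%:R `^ k%:R^-1 * N%:R `^ (- k%:R^-1) :> R ->
  (4 * N < c * M.+1)%N.
Proof.
move=> k_gt0 N_gt0 ltN.
have N_gt0' : 0 < N%:R :> R by rewrite ltr0n.
rewrite powRN; set x : R := a%:R `^ _; set y : R := N%:R `^ _ => dens.
have xk : x ^+ k = a%:R by apply: powR_invn_expn.
have yk : y ^+ k = N%:R by apply: powR_invn_expn.
have x_ge0 : 0 <= x by apply: powR_ge0.
have y_gt0 : 0 < y by apply: powR_gt0.
have ltyx : y < x * M.+1%:R.
  rewrite -(ltr_pXn2r k_gt0) ?nnegrE ?(ltW y_gt0) ?mulr_ge0 //.
  by rewrite exprMn xk yk -natrX -natrM ltr_nat.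
have : 4 < c%:R / N%:R * M.+1%:R :> R.
  apply: (@lt_le_trans _ _ (4 * x / y * M.+1%:R)); last exact: ler_wpM2r.
  by rewrite mulrAC ltr_pdivlMr // -mulrA ltr_pM2l.
by rewrite mulrAC ltr_pdivlMr // -!natrM ltr_nat.
Qed.

(** Pigeonhole: the sums a + P(r), shifted by [T], have only [n] possible values, so two of them
    collide. *)
Lemma exists_value_difference (P : {poly int}) (A : {fset int}) (M n : nat)
    (T : int) :
  (forall (a : int) r, a \in A -> (0 < r <= M)%N -> 1 <= a + P.[r%:Z] + T <= n%:Z) ->
  (n < #|` A| * M)%N ->
  exists r' r'' : nat,
    [/\ (0 < r')%N, (0 < r'')%N, r' <> r'' &
        P.[r'%:Z] - P.[r''%:Z] \in difference_set A].
Proof.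
move=> range ltn_card; apply: contrapT => noP.
(* The shifted sums are positive, so the absolute value merely casts them to [nat]. *)
pose f (a : int) (r : nat) := `|(a + P.[r%:Z] + T)%R|%N.
pose s := [seq f a r | a <- enum_fset A, r <- iota 1 M].
have uniq_s : uniq s.
  apply: allpairs_uniq; rewrite ?fset_uniq ?iota_uniq //.
  move=> _ _ /allpairsP[[a r] /= [aA rM ->]] /allpairsP[[b t] /= [bA tM ->]].
  rewrite /f /=; move: rM tM; rewrite !mem_iota => rM tM eq_f.
  have rM' : (0 < r <= M)%N by lia.
  have tM' : (0 < t <= M)%N by lia.
  have := range a r aA rM'; have := range b t bA tM' => range_b range_a.
  have eq_sum : a + P.[r%:Z] = b + P.[t%:Z] by lia.
  have [eq_rt|/eqP ne_rt] := eqVneq r t.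
    by move: eq_sum; rewrite eq_rt => /addIr ->.
  (* The collision a + P(r) = b + P(t) reads P(r) - P(t) = b - a. *)
  case: noP; exists r, t; split=> //; [lia | lia |].
  apply/imfset2P; exists b => //; exists a => //; lia.
have : (size s <= size (iota 1 n))%N.
  apply: uniq_leq_size => // _ /allpairsP[[a r] /= [aA + ->]].
  rewrite !mem_iota /f => rM.
  have rM' : (0 < r <= M)%N by lia.
  have := range a r aA rM'; lia.
by rewrite size_allpairs !size_iota leqNgt ltn_card.
Qed.

(* r' and r'' are positive: the natural numbers start at 1 here. *)
Theorem theorem3p1 (R : realType) (k : nat) (P : {poly int})
    (hk : (1 <= k)%N) (hdeg : size P = k.+1) (hlead : 0 < P`_k) :
  exists N0 : nat, forall N : nat, (N0 <= N)%N ->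
  forall A : {fset int},
    (forall a : int, a \in A -> 1 <= a <= N%:Z) ->
    (#|` A|)%:R / N%:R >=
      4 * (P`_k)%:~R `^ (k%:R^-1) * N%:R `^ (- k%:R^-1) :> R ->
    exists r' r'' : nat,
      [/\ (0 < r')%N, (0 < r'')%N, r' <> r'' &
          P.[r'%:Z] - P.[r''%:Z] \in difference_set A].
Proof.
have [a Pk] : exists a : nat, P`_k = a%:Z by exists (absz P`_k); lia.
have a_gt0 : (0 < a)%N by lia.
have [S sumP] : exists S : nat, \sum_(i < k) `|P`_i| = S%:Z.
  exists (absz (\sum_(i < k) `|P`_i|)); rewrite gez0_abs //.
  by apply: sumr_ge0.
(* This threshold forces [M >= 2 * S + 3]: the part [2 * S < M] gives [2 * T < N] below, and
   [M >= 3] gives 4M / (M + 1) >= 3. *)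
exists (a * (2 * S + 3) ^ k)%N => N leN0 A rangeA dens.
have [M /andP[leM ltM]] := exists_max_scaled_power N a_gt0 hk.
have M_ge : (2 * S + 3 <= M)%N.
  have := leq_ltn_trans leN0 ltM.
  by rewrite ltn_pmul2l // ltn_exp2r // ltnS.
have N_gt0 : (0 < N)%N.
  by apply: leq_trans leN0; rewrite muln_gt0 a_gt0 expn_gt0 addnS.
rewrite Pk in dens.
have card_gt := card_gt_of_density hk N_gt0 ltM dens.
pose T := (S * M ^ k.-1)%N.
have T_le : (2 * T < N)%N.
  apply: leq_trans leM; apply: (@leq_trans (M ^ k)); last first.
    by rewrite leq_pmull.
  rewrite -[in leqRHS](prednK hk) expnS /T mulnA ltn_pmul2r ?expn_gt0; lia.
(* Both [b] and [a * r ^ k] are at most [N], and the lower terms of P(r) contribute at most [T] in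
   absolute value. The count closes by 2N + 2T < 3N <= |A| M. *)
apply: (@exists_value_difference _ _ M (2 * N + 2 * T) T%:Z); last nia.
move=> b r bA /andP[r_gt0 leMr].
have := horner_lead_dist hk hdeg r_gt0; rewrite Pk sumP -!rmorphXn /= => dist.
have le1 : (S * r ^ k.-1 <= T)%N.
  by rewrite leq_mul //; case: k.-1 => [|j] //; rewrite leq_exp2r.
have le2 : (a * r ^ k <= N)%N.
  by apply: leq_trans leM; rewrite leq_mul // leq_exp2r.
have := rangeA b bA; lia.
Qed.
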